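(* Let $m,n$ be positive integers, let $G=K_{m,n}$ be the complete bipartite graph, and let $R$ be the set of all vertices of one part of $G$. Then $$w_R(G)=(m+n-|R|)\cdot\left\lceil\frac{|R|}{m+n-|R|}\right\rceil.$$
   Context: All graphs are finite, undirected, without loops or multiple edges. An interval is a nonempty set of consecutive integers; $[p,q]$ denotes the interval with minimum $p$ and maximum $q$. A proper edge $t$-coloring of a graph $G$ is a function $\varphi:E(G)\to[1,t]$ such that every color in $[1,t]$ is used and no two adjacent edges receive the same color. For a vertex $x$, its spectrum under $\varphi$ is $S_G(x,\varphi)=\{\varphi(e): e\in E(G),\ e \text{ incident with } x\}$. A proper edge coloring $\varphi$ is interval in $x$ if $S_G(x,\varphi)$ is an interval, and interval on a set $R\subseteq V(G)$ if it is interval in every $x\in R$. For a subset $R\subseteq V(G)$ for which some proper edge coloring of $G$ interval on $R$ exists, $w_R(G)$ denotes the minimum $t$ such that there exists a proper edge $t$-coloring of $G$ interval on $R$. *)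

(* Defs.v *)
From HB Require Import structures.
From mathcomp Require Import all_boot all_order all_algebra.

Set Implicit Arguments.
Unset Strict Implicit.
Unset Printing Implicit Defensive.

Record sgraph := SGraph {
  vertex :> finType;
  adj : rel vertex;
  adj_sym : symmetric adj;
  adj_irr : irreflexive adj
}.

Definition edges (G : sgraph) : {set {set G}} :=
  [set [set x; y] | x in G, y in adj x].

Definition adjacent_edges (G : sgraph) (e f : {set G}) : bool :=
  (e != f) && (e :&: f != set0).

(* A coloring is a function on all vertex sets of which only the values on
   edges G matter; every definition below restricts to edges. *)
Definition proper_edge_coloring (G : sgraph) (t : nat) (phi : {set G} -> nat) :=
  [/\ {in edges G, forall e, 1 <= phi e <= t},
      forall c, 1 <= c <= t -> exists2 e, e \in edges G & phi e = c
    & {in edges G &, forall e f, adjacent_edges e f -> phi e != phi f}].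

Definition spectrum (G : sgraph) (phi : {set G} -> nat) (x : G) : seq nat :=
  [seq phi e | e in [set e in edges G | x \in e]].

(* Colors are positive, so intervals of integers may be taken in nat;
   p <= q encodes nonemptiness. *)
Definition is_interval (s : seq nat) :=
  exists p q : nat, p <= q /\ forall c, (c \in s) = (p <= c <= q).

Definition interval_on (G : sgraph) (R : {set G}) (phi : {set G} -> nat) :=
  {in R, forall x, is_interval (spectrum phi x)}.

Definition colorable_interval_on (G : sgraph) (R : {set G}) (t : nat) :=
  exists2 phi : {set G} -> nat,
    proper_edge_coloring t phi & interval_on R phi.

(* w_R(G) is a partial function of (G, R), hence is given by its graph:
   is_w R t holds iff w_R(G) is defined and equal to t. *)
Definition is_w (G : sgraph) (R : {set G}) (t : nat) :=
  colorable_interval_on R t /\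
  forall t', colorable_interval_on R t' -> t <= t'.

Section CompleteBipartite.
Variables m n : nat.

Definition Kadj : rel ('I_m + 'I_n) :=
  fun x y => match x, y with
             | inl _, inr _ | inr _, inl _ => true
             | _, _ => false
             end.

Lemma Kadj_sym : symmetric Kadj. Proof. by case=> x [] y. Qed.
Lemma Kadj_irr : irreflexive Kadj. Proof. by case. Qed.

Definition K : sgraph := SGraph Kadj_sym Kadj_irr.

Definition left_part : {set K} := [set inl i | i : 'I_m].
Definition right_part : {set K} := [set inr j | j : 'I_n].

End CompleteBipartite.

(* Main.v *)
(** Let r = |R| and let s be the size of the other part, so that the spectrum of
    each x in R consists of s consecutive colors.

    Lower bound: each such spectrum contains a multiple of s, and an edge at x
    whose color is a multiple of s, recorded by its color and its endpoint
    outside R, determines x.  In [1, t] there are t %/ s multiples of s, hence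
    r <= (t %/ s) * s, and t >= s * ceil(r / s).

    Upper bound: split R into ceil(r / s) blocks of at most s vertices and color
    the edges at the a-th block by a cyclic Latin square on the colors
    [a * s + 1, a * s + s]. *)
Require Import Defs.
From HB Require Import structures.
From mathcomp Require Import all_boot all_order all_algebra.
From mathcomp Require Import zify.
Import Order.TTheory GRing.Theory Num.Theory.
Local Open Scope ring_scope.

(** The parts are [R] and [~: R]; stated for an arbitrary graph so that one argument serves both
    choices of [R] in [K m n]. *)
Definition complete_bipartite_on (G : sgraph) (R : {set G}) :=
  forall x y : G, adj x y = (x \in R) (+) (y \in R).

Section CompleteBipartiteOn.
Local Open Scope nat_scope.
Context (G : sgraph) (R : {set G}) (GR : complete_bipartite_on G R).

Let r := #|R|.
Let s := #|~: R|.

(** * Edges and spectra seen from [R] *)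

Lemma edge_across (x y : G) : x \in R -> y \notin R -> [set x; y] \in edges G.
Proof.
move=> xR yR; apply/imset2P; exists x y => //.
by rewrite -topredE /= GR xR (negbTE yR).
Qed.

Lemma edgesP (e : {set G}) :
  reflect (exists x y, [/\ x \in R, y \notin R & e = [set x; y]]) (e \in edges G).
Proof.
apply: (iffP idP) => [/imset2P[x y _]|[x [y [xR yR ->]]]]; last exact: edge_across.
rewrite -topredE /= GR; case xR: (x \in R); case yR: (y \in R) => // _ ->.
  by exists x, y; rewrite xR yR.
by exists y, x; rewrite xR yR setUC.
Qed.

Lemma edge_capR {x y : G} : x \in R -> y \notin R -> [set x; y] :&: R = [set x].
Proof.
move=> xR yR; apply/setP => z; rewrite !inE.
by case: eqVneq => [->|_] /=; [rewrite xR|case: eqVneq => [->|] //=; apply: negbTE].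
Qed.

Lemma edge_diffR {x y : G} : x \in R -> y \notin R -> [set x; y] :\: R = [set y].
Proof.
move=> xR yR; apply/setP => z; rewrite !inE.
case: (eqVneq z y) => [->|_] /=; first by rewrite yR orbT.
by rewrite orbF; case: eqVneq => [->|]; rewrite ?xR ?andbF.
Qed.

Lemma edge_across_inj (x y x' y' : G) :
  x \in R -> y \notin R -> x' \in R -> y' \notin R ->
  [set x; y] = [set x'; y'] -> x = x' /\ y = y'.
Proof.
move=> xR yR x'R y'R E; split; apply: set1_inj.
  by rewrite -(edge_capR xR yR) E edge_capR.
by rewrite -(edge_diffR xR yR) E edge_diffR.
Qed.

Lemma spectrumP (phi : {set G} -> nat) (x : G) (c : nat) : x \in R ->
  reflect (exists2 y, y \notin R & c = phi [set x; y]) (c \in spectrum phi x).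
Proof.
move=> xR; apply: (iffP imageP) => [[e]|[y yR ->]]; last first.
  by exists [set x; y]; rewrite // !inE eqxx edge_across.
rewrite inE => /andP[/edgesP[x' [y [x'R yR ->]]]].
rewrite !inE => /orP[] /eqP E ->; last by rewrite -E xR in yR.
by exists y; rewrite ?E.
Qed.

(** * Lower bound: counting colors divisible by [s] *)

Section Coloring.
Context {t : nat} {phi : {set G} -> nat} (phiP : proper_edge_coloring t phi).

Lemma proper_inj_inR (y x x' : G) : y \notin R -> x \in R -> x' \in R ->
  phi [set x; y] = phi [set x'; y] -> x = x'.
Proof.
case: phiP => _ _ H yR xR x'R E; apply/eqP/negPn/negP => /eqP ne.
suff /(H _ _ (edge_across x y xR yR) (edge_across x' y x'R yR)) :
  adjacent_edges [set x; y] [set x'; y] by rewrite E eqxx.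
apply/andP; split; first by apply/eqP => /edge_across_inj[].
by apply/set0Pn; exists y; rewrite !inE eqxx !orbT.
Qed.

Lemma proper_inj_outR (x y y' : G) : x \in R -> y \notin R -> y' \notin R ->
  phi [set x; y] = phi [set x; y'] -> y = y'.
Proof.
case: phiP => _ _ H xR yR y'R E; apply/eqP/negPn/negP => /eqP ne.
suff /(H _ _ (edge_across x y xR yR) (edge_across x y' xR y'R)) :
  adjacent_edges [set x; y] [set x; y'] by rewrite E eqxx.
apply/andP; split; first by apply/eqP => /edge_across_inj[].
by apply/set0Pn; exists x; rewrite !inE eqxx.
Qed.

(** The [s] edges at [x] have distinct colors, so [[p, q]] contains at least [s] consecutive
    integers. *)
Lemma interval_has_multiple (x : G) : 0 < s -> x \in R ->
  is_interval (spectrum phi x) ->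
  exists2 y, y \notin R & s %| phi [set x; y].
Proof.
move=> s0 xR [p [q [pq Hpq]]].
have le_s : s <= q.+1 - p.
  rewrite -(size_iota p (q.+1 - p)) /s cardE -(size_map (fun y => phi [set x; y])).
  apply: uniq_leq_size => [|c /mapP[y]].
    rewrite map_inj_in_uniq ?enum_uniq // => y y'.
    by rewrite !mem_enum !inE => yR y'R; apply: proper_inj_outR.
  rewrite mem_enum inE => yR ->; rewrite mem_iota.
  have : phi [set x; y] \in spectrum phi x by apply/spectrumP => //; exists y.
  rewrite Hpq; lia.
(* This is the least multiple of [s] that is at least [p]; it is at most [p + s.-1 <= q]. *)
have : (p + s.-1) %/ s * s \in spectrum phi x.
  rewrite Hpq; have := divn_eq (p + s.-1) s; have := ltn_pmod (p + s.-1) s0; lia.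
by case/spectrumP => // y yR E; exists y; rewrite // -E dvdn_mull.
Qed.

Lemma interval_on_card_le : 0 < s -> interval_on R phi -> r <= t %/ s * s.
Proof.
move=> s0 phiI.
(* The default [x] is never taken when [x] is in [R], as [fP] shows. *)
pose f x := odflt x [pick y | (y \notin R) && (s %| phi [set x; y])].
have fP x : x \in R -> f x \notin R /\ s %| phi [set x; f x].
  move=> xR; rewrite /f; case: pickP => [y /andP[]//|no].
  have [y yR sy] := interval_has_multiple x s0 xR (phiI x xR).
  by have := no y; rewrite yR sy.
pose g x := (phi [set x; f x], f x).
pose multiples := [seq k * s | k <- iota 1 (t %/ s)].
have -> : t %/ s * s = size [seq (c, y) | c <- multiples, y <- enum (~: R)].
  by rewrite size_allpairs size_map size_iota -cardE.
rewrite /r cardE -(size_map g); apply: uniq_leq_size => [|z /mapP[x]].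
  rewrite map_inj_in_uniq ?enum_uniq // => x x'; rewrite !mem_enum => xR x'R [].
  have [fxR _] := fP x xR => + E; rewrite -E.
  exact: proper_inj_inR.
rewrite mem_enum => xR -> {z}; have [fxR sfx] := fP x xR.
apply: allpairs_f; last by rewrite mem_enum inE.
case: phiP => /(_ _ (edge_across x (f x) xR fxR)) /andP[c1 ct] _ _.
apply/mapP; exists (phi [set x; f x] %/ s); last by rewrite divnK.
(* Colors are positive, so the multiple [0] is excluded and the quotient lies in [[1, t %/ s]]. *)
by rewrite mem_iota add1n ltnS leq_div2r // andbT divn_gt0 // dvdn_leq.
Qed.

End Coloring.

(** * Upper bound: cyclic Latin squares on blocks of colors *)

Lemma addn_modn_inj (b j j' : nat) : j < s -> j' < s ->
  (b + j) %% s = (b + j') %% s -> j = j'.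
Proof. by move=> js j's /eqP; rewrite eqn_modDl !modn_small //; apply: eqP. Qed.

(** Colors are counted from [0] here: row [i] belongs to block [i %/ s], and each block is a shifted
    addition table modulo [s]. *)
Definition block_color (i j : nat) := i %/ s * s + (i %% s + j) %% s.

Lemma block_color_div (i j : nat) : 0 < s -> block_color i j %/ s = i %/ s.
Proof. by move=> s0; rewrite /block_color divnMDl // (divn_small (ltn_pmod _ s0)) addn0. Qed.

Lemma block_color_mod (i j : nat) : block_color i j %% s = (i %% s + j) %% s.
Proof. by rewrite /block_color modnMDl modn_mod. Qed.

(** The quotient of the color by [s] gives the block of [i]; its remainder gives [i %% s] after
    cancelling [j] modulo [s]. *)
Lemma block_color_injl (j i i' : nat) : 0 < s ->
  block_color i j = block_color i' j -> i = i'.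
Proof.
move=> s0 E; rewrite (divn_eq i s) (divn_eq i' s).
rewrite -(block_color_div i j) // -(block_color_div i' j) // E; congr (_ + _).
apply: (addn_modn_inj j); rewrite ?ltn_pmod //.
by rewrite ![j + _]addnC -!block_color_mod E.
Qed.

Lemma block_color_injr (i j j' : nat) : j < s -> j' < s ->
  block_color i j = block_color i j' -> j = j'.
Proof. by move=> js j's /addnI; apply: addn_modn_inj. Qed.

Lemma block_color_surj (i c : nat) : i %/ s * s <= c < i %/ s * s + s ->
  exists2 j, j < s & block_color i j = c.
Proof.
move=> ic; have s0 : 0 < s by lia.
have ims := ltn_pmod i s0.
(* The offset of [c] in its block minus [i %% s], modulo [s]; the added [s] keeps the subtraction
   within [nat]. *)
exists ((c - i %/ s * s + (s - i %% s)) %% s); first by rewrite ltn_pmod.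
rewrite /block_color modnDmr.
have -> : i %% s + (c - i %/ s * s + (s - i %% s)) = s + (c - i %/ s * s) by lia.
by rewrite modnDl modn_small; lia.
Qed.

(* [\sum_(x in e :&: R)] extracts the value at the only endpoint of [e] in [R]. *)
Definition block_coloring (e : {set G}) : nat :=
  (block_color (\sum_(x in e :&: R) index x (enum R))
               (\sum_(y in e :\: R) index y (enum (~: R)))).+1.

Lemma block_coloringE (x y : G) : x \in R -> y \notin R ->
  block_coloring [set x; y] =
  (block_color (index x (enum R)) (index y (enum (~: R)))).+1.
Proof. by move=> xR yR; rewrite /block_coloring edge_capR // edge_diffR // !big_set1. Qed.

Lemma index_enum_lt (A : {set G}) (x : G) : x \in A -> index x (enum A) < #|A|.
Proof. by move=> xA; rewrite cardE index_mem mem_enum. Qed.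

Lemma index_enum_inj (A : {set G}) (x y : G) : x \in A -> y \in A ->
  index x (enum A) = index y (enum A) -> x = y.
Proof.
move=> xA yA E; rewrite -(nth_index x (s := enum A) (x := x)) ?mem_enum // E.
by rewrite nth_index ?mem_enum.
Qed.

Lemma index_enum_surj (A : {set G}) (i : nat) : i < #|A| ->
  exists2 x, x \in A & index x (enum A) = i.
Proof.
rewrite cardE; case E: (enum A) => [//|x0 l]; rewrite -E => iA.
exists (nth x0 (enum A) i); first by rewrite -mem_enum mem_nth.
by rewrite index_uniq ?enum_uniq.
Qed.

(** The number just below the colors at [x], which run from [block_start x + 1] to
    [block_start x + s] because [block_coloring] adds one. *)
Definition block_start (x : G) := index x (enum R) %/ s * s.

Lemma block_coloring_surj (x : G) (c : nat) : x \in R ->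
  block_start x < c <= block_start x + s ->
  exists2 y, y \notin R & block_coloring [set x; y] = c.
Proof.
move=> xR xc; have [|j js E] := @block_color_surj (index x (enum R)) c.-1.
  by move: xc; rewrite /block_start; lia.
have [y yR Ey] := index_enum_surj (~: R) j js; rewrite inE in yR.
by exists y; rewrite // block_coloringE // Ey E; lia.
Qed.

Lemma block_coloring_range (x y : G) : x \in R -> y \notin R -> 0 < s ->
  block_start x < block_coloring [set x; y] <= block_start x + s.
Proof.
move=> xR yR s0; rewrite block_coloringE // /block_color /block_start.
have := ltn_pmod (index x (enum R) %% s + index y (enum (~: R))) s0; lia.
Qed.

(** No color is missed even if the last block of vertices is incomplete: a single vertex of [R]
    already sees all [s] colors of its block. *)
Lemma block_coloring_proper : 0 < s ->
  proper_edge_coloring (s * ((r + s.-1) %/ s)) block_coloring.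
Proof.
move=> s0; split.
- move=> _ /edgesP[x [y [xR yR ->]]].
  have := block_coloring_range x y xR yR s0.
  have ir : index x (enum R) < r by apply: index_enum_lt.
  have : (index x (enum R) %/ s).+1 * s <= s * ((r + s.-1) %/ s).
    (* Writing [1] as [s %/ s] reduces the bound to [index x (enum R) + s <= r + s.-1]. *)
    rewrite mulnC leq_mul2l -addn1 -[1](congr1 nat_of_bool s0) -divnn -divnDr //.
    by rewrite leq_div2r ?orbT //; lia.
  rewrite mulSn addnC => le_t /andP[lt_c c_le].
  by rewrite (leq_trans c_le le_t) (leq_ltn_trans _ lt_c).
- move=> c /andP[c1 ct].
  (* The index of the first vertex in the block of [c]; that vertex will carry the color [c]. *)
  have i_lt : c.-1 %/ s * s < r.
    have : c.-1 %/ s < (r + s.-1) %/ s by rewrite ltn_divLR // mulnC prednK.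
    by rewrite leq_divRL // mulSn; lia.
  have [x xR Ex] := index_enum_surj R _ i_lt.
  have [|y yR E] := block_coloring_surj x c xR.
    rewrite /block_start Ex mulnK //; have := divn_eq c.-1 s; have := ltn_pmod c.-1 s0; lia.
  by exists [set x; y]; first exact: edge_across.
- move=> _ _ /edgesP[x [y [xR yR ->]]] /edgesP[x' [y' [x'R y'R ->]]].
  case/andP => ne /set0Pn[z]; rewrite !inE => zz; apply/eqP => E; case/negP: ne.
  (* A common vertex lies either in [R] or outside it; the mixed cases contradict membership. *)
  have [xx|yy] : x = x' \/ y = y'.
    case/andP: zz => /orP[] /eqP -> /orP[] /eqP E'; [by left| | |by right].
      by rewrite -E' xR in y'R.
    by rewrite E' x'R in yR.
  - move: E; rewrite !block_coloringE // -xx => -[] /block_color_injr E.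
    by rewrite (@index_enum_inj (~: R) y y') ?inE // E // index_enum_lt ?inE.
  - move: E; rewrite !block_coloringE // -yy => -[] /(block_color_injl _ _ _ s0) E.
    by rewrite (index_enum_inj R x x').
Qed.

Lemma block_coloring_interval : 0 < s -> interval_on R block_coloring.
Proof.
move=> s0 x xR; exists (block_start x).+1, (block_start x + s); split=> [|c]; first by lia.
apply/spectrumP/idP => // [[y yR ->]|ac]; first exact: block_coloring_range.
by have [y yR E] := block_coloring_surj x c xR ac; exists y.
Qed.

Lemma is_w_complete_bipartite : 0 < s -> is_w R (s * ((r + s.-1) %/ s)).
Proof.
move=> s0; split=> [|t [phi phiP phiI]].
  exists block_coloring; [exact: block_coloring_proper|exact: block_coloring_interval].
(* As [t %/ s * s <= t], it suffices that the rounded-up quotient of [r] by [s] is at most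
   [t %/ s]. *)
apply: leq_trans (leq_divM t s); rewrite mulnC leq_mul2r -ltnS ltn_divLR //.
by have := interval_on_card_le phiP s0 phiI; rewrite mulSn; lia.
Qed.

End CompleteBipartiteOn.

(** * The rational ceiling and the graph [K m n] *)

Lemma ceil_natq_div (r s : nat) : (0 < s)%N ->
  Num.ceil (r%:Q / s%:Q) = ((r + s.-1) %/ s)%N.
Proof.
move=> s0; apply/eqP; have s0q : 0 < s%:Q by rewrite ltr0z; lia.
(* With [c] the natural quotient, clearing denominators leaves [(c - 1) * s < r <= c * s], which
   follows from Euclidean division of [r + s.-1]. *)
rewrite ceil_eq ltr_pdivlMr // ler_pdivrMr // -intrM -intrM ltr_int ler_int.
have := divn_eq (r + s.-1) s; have := ltn_pmod (r + s.-1) s0; nia.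
Qed.

Theorem theorem4 (m n : nat) (hm : (0 < m)%N) (hn : (0 < n)%N)
    (R : {set K m n}) (hR : R = left_part m n \/ R = right_part m n) :
  exists2 w : nat, is_w R w
    & w%:Z = (m + n - #|R|)%N%:Z
             * Num.ceil ((#|R|)%:Q / (m + n - #|R|)%N%:Q).
Proof.
have inl_inj : injective (@inl 'I_m 'I_n) by move=> ? ? [].
have inr_inj : injective (@inr 'I_m 'I_n) by move=> ? ? [].
have GR : complete_bipartite_on (K m n) R.
  have no_inl i : (inl i : K m n) \in right_part m n = false.
    by apply/imsetP => -[].
  have no_inr i : (inr i : K m n) \in left_part m n = false.
    by apply/imsetP => -[].
  have is_inl i : (inl i : K m n) \in left_part m n by apply: imset_f.
  have is_inr i : (inr i : K m n) \in right_part m n by apply: imset_f.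
  by case: hR => -> [x|x] [y|y]; rewrite ?no_inl ?no_inr ?is_inl ?is_inr.
have cardR : #|~: R| = (m + n - #|R|)%N.
  by have := cardsC R; rewrite card_sum !card_ord; lia.
have s0 : (0 < m + n - #|R|)%N.
  by case: hR => ->; rewrite card_imset // card_ord; lia.
exists ((m + n - #|R|) * ((#|R| + (m + n - #|R|).-1) %/ (m + n - #|R|)))%N.
  by rewrite -cardR; apply: is_w_complete_bipartite; rewrite ?cardR.
by rewrite ceil_natq_div // PoszM.
Qed.
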